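(* Let $\theta\in\mathbb{R}^{n_\theta}$, let $\boldsymbol{\tau}^*$ be a solution of the parameterized optimal control problem for this fixed $\theta$, let $\boldsymbol{\lambda}^*$ be Lagrange multipliers such that $\boldsymbol{z}^*=(\boldsymbol{\tau}^*,\boldsymbol{\lambda}^* )$ satisfies $\nabla_{\boldsymbol{z}}\mathcal{L}(\boldsymbol{z}^*,\theta)=0$, and assume that $\mathcal{L}_{\boldsymbol{z}\boldsymbol{z}}(\boldsymbol{z}^*,\theta)$ is invertible. Then the differentiable Pontryagin conditions are equivalent to the linear system $\frac{\partial\boldsymbol{z}^*}{\partial\theta}=-\mathcal{L}_{\boldsymbol{z}\boldsymbol{z}}^{-1}\mathcal{L}_{\boldsymbol{z}\theta}$. That is, matrices $\frac{\partial\lambda_k}{\partial\theta},\frac{\partial x_k}{\partial\theta}\in\mathbb{R}^{n_x\times n_\theta}$ $(k=0,\dots,N)$ and $\frac{\partial u_k}{\partial\theta}\in\mathbb{R}^{n_u\times n_\theta}$ $(k=0,\dots,N-1)$ satisfy $$\begin{aligned} \frac{\partial x_0}{\partial\theta}&=\xi_\theta,\\ \frac{\partial x_{k+1}}{\partial\theta}&=f_{x_k}\frac{\partial x_k}{\partial\theta}+f_{u_k}\frac{\partial u_k}{\partial\theta}+f_{\theta_k},\\ \frac{\partial\lambda_k}{\partial\theta}&=\mathcal{L}_{xx}^{(k)}\frac{\partial x_k}{\partial\theta}+\mathcal{L}_{xu}^{(k)}\frac{\partial u_k}{\partial\theta}+f_{x_k}^\top\frac{\partial\lambda_{k+1}}{\partial\theta}+\mathcal{L}_{x\theta}^{(k)},\\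 0&=\mathcal{L}_{ux}^{(k)}\frac{\partial x_k}{\partial\theta}+\mathcal{L}_{uu}^{(k)}\frac{\partial u_k}{\partial\theta}+f_{u_k}^\top\frac{\partial\lambda_{k+1}}{\partial\theta}+\mathcal{L}_{u\theta}^{(k)},\\ \frac{\partial\lambda_N}{\partial\theta}&=\phi_{xx}\frac{\partial x_N}{\partial\theta}+\phi_{x\theta} \end{aligned}$$ (for all $k=0,\dots,N-1$, with all derivatives evaluated along $\boldsymbol{z}^*$) if and only if the stacked matrix $\frac{\partial\boldsymbol{z}^*}{\partial\theta}=\big(\frac{\partial\lambda_0}{\partial\theta},\frac{\partial x_0}{\partial\theta},\frac{\partial u_0}{\partial\theta},\dots,\frac{\partial\lambda_N}{\partial\theta},\frac{\partial x_N}{\partial\theta}\big)$ (blocks stacked vertically) satisfies $\frac{\partial\boldsymbol{z}^*}{\partial\theta}=-\mathcal{L}_{\boldsymbol{z}\boldsymbol{z}}^{-1}\mathcal{L}_{\boldsymbol{z}\theta}$, with the right-hand side evaluated at $(\boldsymbol{z}^*,\theta)$.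
   Context: Let $N,n_x,n_u,n_\theta$ be positive integers. The parameterized optimal control problem is, for $\theta\in\mathbb{R}^{n_\theta}$, $$\boldsymbol{\tau}^*(\theta)\in\arg\min_{\boldsymbol{\tau}}\ \sum_{k=0}^{N-1}\ell(x_k,u_k,\theta)+\phi(x_N,\theta)\quad\text{subject to } x_{k+1}=f(x_k,u_k,\theta)\ (k=0,\dots,N-1),\quad x_0=\xi(\theta),$$ where $\boldsymbol{\tau}=(x_0,u_0,x_1,u_1,\dots,x_N)$ with $x_k\in\mathbb{R}^{n_x}$, $u_k\in\mathbb{R}^{n_u}$; the functions $f:\mathbb{R}^{n_x}\times\mathbb{R}^{n_u}\times\mathbb{R}^{n_\theta}\to\mathbb{R}^{n_x}$, $\ell:\mathbb{R}^{n_x}\times\mathbb{R}^{n_u}\times\mathbb{R}^{n_\theta}\to\mathbb{R}$, $\phi:\mathbb{R}^{n_x}\times\mathbb{R}^{n_\theta}\to\mathbb{R}$ are twice continuously differentiable and $\xi:\mathbb{R}^{n_\theta}\to\mathbb{R}^{n_x}$ is continuously differentiable. The Lagrangian is $$\mathcal{L}(\boldsymbol{z},\theta)=\sum_{k=0}^{N-1}\Big(\ell(x_k,u_k,\theta)+\lambda_{k+1}^\top\big(f(x_k,u_k,\theta)-x_{k+1}\big)\Big)+\lambda_0^\top(\xi(\theta)-x_0)+\phi(x_N,\theta),$$ with multipliers $\lambda_k\in\mathbb{R}^{n_x}$, $k=0,\dots,N$, and $\boldsymbol{z}=(\boldsymbol{\tau},\boldsymbol{\lambda})=(\lambda_0,x_0,u_0,\lambda_1,x_1,u_1,\dots,\lambda_N,x_N)$.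 Notation: $\mathcal{L}_{\boldsymbol{z}\boldsymbol{z}}=\partial_{\boldsymbol{z}}\nabla_{\boldsymbol{z}}\mathcal{L}$ is the Hessian in $\boldsymbol{z}$ and $\mathcal{L}_{\boldsymbol{z}\theta}=\partial_\theta\nabla_{\boldsymbol{z}}\mathcal{L}$. For $k=0,\dots,N-1$, $f_{x_k},f_{u_k},f_{\theta_k}$ are the Jacobians of $f$ in $x,u,\theta$ at $(x_k,u_k,\theta)$; $\mathcal{L}^{(k)}_{xx},\mathcal{L}^{(k)}_{xu},\mathcal{L}^{(k)}_{ux},\mathcal{L}^{(k)}_{uu},\mathcal{L}^{(k)}_{x\theta},\mathcal{L}^{(k)}_{u\theta}$ are the blocks of second partial derivatives of $\mathcal{L}$ with respect to the indicated variables among $x_k,u_k,\theta$ (for example $\mathcal{L}^{(k)}_{x\theta}=\partial_\theta\nabla_{x_k}\mathcal{L}$); $\xi_\theta$ is the Jacobian of $\xi$; $\phi_{xx}$ and $\phi_{x\theta}=\partial_\theta\nabla_x\phi$ are second derivatives of $\phi$ at $(x_N,\theta)$. *)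

(* Defs.v *)
(* Vectors of R^n are column vectors. *)
From HB Require Import structures.
From mathcomp Require Import all_boot all_order all_algebra.
From mathcomp Require Import all_classical all_reals all_analysis.

Set Implicit Arguments.
Unset Strict Implicit.
Unset Printing Implicit Defensive.

Import Order.TTheory GRing.Theory Num.Theory.
Import numFieldNormedType.Exports.

Local Open Scope classical_set_scope.
Local Open Scope ring_scope.

(* On a finite-dimensional V, continuity of every 'D_v f is continuity of the
   derivative x |-> 'd f x itself. *)
Definition C1 (R : realType) (V W : normedModType R) (f : V -> W) : Prop :=
  (forall x, differentiable f x) /\ (forall v, continuous ('D_v f)).

Definition C2 (R : realType) (V W : normedModType R) (f : V -> W) : Prop :=
  (forall x, differentiable f x) /\ (forall v, C1 ('D_v f)).

Definition grad (R : realType) (n : nat) (g : 'cV[R]_n -> R) (x : 'cV[R]_n)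
    : 'cV[R]_n :=
  \col_i 'D_(delta_mx i 0) g x.

(* The library's [jacobian] is for maps between row vectors, and is the
   transpose of the usual matrix. Here entry (i, j) is the partial derivative
   of component i along coordinate j. *)
Definition Jac (R : realType) (m n : nat) (F : 'cV[R]_n -> 'cV[R]_m)
    (x : 'cV[R]_n) : 'M[R]_(m, n) :=
  \matrix_(i, j) 'D_(delta_mx j 0) (fun y => F y i 0) x.

Record ocp (R : realType) (nx nu nth : nat) := Ocp {
  dyn : 'cV[R]_nx * 'cV[R]_nu * 'cV[R]_nth -> 'cV[R]_nx;
  stage_cost : 'cV[R]_nx * 'cV[R]_nu * 'cV[R]_nth -> R;
  final_cost : 'cV[R]_nx * 'cV[R]_nth -> R;
  init : 'cV[R]_nth -> 'cV[R]_nx }.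

(* The indices k and k + 1 of 0, ..., N, for k < N. *)
Definition cur (N : nat) (k : 'I_N) : 'I_N.+1 := widen_ord (leqnSn N) k.
Definition nxt (N : nat) (k : 'I_N) : 'I_N.+1 := lift ord0 k.

Definition feasible (R : realType) (N nx nu nth : nat) (P : ocp R nx nu nth)
    (th : 'cV[R]_nth) (x : 'I_N.+1 -> 'cV[R]_nx) (u : 'I_N -> 'cV[R]_nu)
    : Prop :=
  (forall k, x (nxt k) = dyn P (x (cur k), u k, th)) /\ x ord0 = init P th.

Definition cost (R : realType) (N nx nu nth : nat) (P : ocp R nx nu nth)
    (th : 'cV[R]_nth) (x : 'I_N.+1 -> 'cV[R]_nx) (u : 'I_N -> 'cV[R]_nu) : R :=
  \sum_(k < N) stage_cost P (x (cur k), u k, th) + final_cost P (x ord_max, th).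

Definition solution (R : realType) (N nx nu nth : nat) (P : ocp R nx nu nth)
    (th : 'cV[R]_nth) (x : 'I_N.+1 -> 'cV[R]_nx) (u : 'I_N -> 'cV[R]_nu)
    : Prop :=
  feasible P th x u /\
  forall (x' : 'I_N.+1 -> 'cV[R]_nx) (u' : 'I_N -> 'cV[R]_nu),
    feasible P th x' u' -> cost P th x u <= cost P th x' u'.

Definition lagrangian (R : realType) (N nx nu nth : nat) (P : ocp R nx nu nth)
    (lam x : 'I_N.+1 -> 'cV[R]_nx) (u : 'I_N -> 'cV[R]_nu) (th : 'cV[R]_nth)
    : R :=
  \sum_(k < N) (stage_cost P (x (cur k), u k, th) +
     ((lam (nxt k))^T *m (dyn P (x (cur k), u k, th) - x (nxt k))) 0 0)
  + ((lam ord0)^T *m (init P th - x ord0)) 0 0 + final_cost P (x ord_max, th).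

(* Stacked order: (lam_k, x_k, u_k) for k < N, followed by (lam_N, x_N). *)
Definition nz (N nx nu : nat) : nat :=
  (\sum_(k < N) (nx + (nx + nu)) + (nx + nx))%N.

(* p = 1 stacks a point z; p = dim theta stacks a candidate for dz/dtheta. *)
Definition stack (R : realType) (N nx nu p : nat)
    (lam x : 'I_N.+1 -> 'M[R]_(nx, p)) (u : 'I_N -> 'M[R]_(nu, p))
    : 'M[R]_(nz N nx nu, p) :=
  col_mx
    (\mxcol_(k < N) col_mx (lam (cur k)) (col_mx (x (cur k)) (u k)))
    (col_mx (lam ord_max) (x ord_max)).

Definition stage_block (R : realType) (N nx nu p : nat)
    (z : 'M[R]_(nz N nx nu, p)) (k : 'I_N) : 'M[R]_(nx + (nx + nu), p) :=
  @submxcol R N (fun=> (nx + (nx + nu))%N) p (usubmx z) k.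

Definition lam_of (R : realType) (N nx nu p : nat)
    (z : 'M[R]_(nz N nx nu, p)) (k : 'I_N.+1) : 'M[R]_(nx, p) :=
  if unlift ord_max k is Some j then usubmx (stage_block z j)
  else usubmx (dsubmx z).

Definition x_of (R : realType) (N nx nu p : nat)
    (z : 'M[R]_(nz N nx nu, p)) (k : 'I_N.+1) : 'M[R]_(nx, p) :=
  if unlift ord_max k is Some j then usubmx (dsubmx (stage_block z j))
  else dsubmx (dsubmx z).

Definition u_of (R : realType) (N nx nu p : nat)
    (z : 'M[R]_(nz N nx nu, p)) (k : 'I_N) : 'M[R]_(nu, p) :=
  dsubmx (dsubmx (stage_block z k)).

Lemma lift_max_cur (N : nat) (k : 'I_N) : lift ord_max k = cur k.
Proof. by apply: val_inj; rewrite /= /bump leqNgt ltn_ord. Qed.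

Lemma stackK (R : realType) (N nx nu p : nat)
    (lam x : 'I_N.+1 -> 'M[R]_(nx, p)) (u : 'I_N -> 'M[R]_(nu, p)) :
  [/\ lam_of (stack lam x u) = lam, x_of (stack lam x u) = x
    & u_of (stack lam x u) = u].
Proof.
have sb k : stage_block (stack lam x u) k =
    col_mx (lam (cur k)) (col_mx (x (cur k)) (u k)).
  by rewrite /stage_block /stack col_mxKu mxcolK.
split; apply/funext => k.
- rewrite /lam_of; case: unliftP => [j ->|->].
    by rewrite sb col_mxKu lift_max_cur.
  by rewrite /stack col_mxKd col_mxKu.
- rewrite /x_of; case: unliftP => [j ->|->].
    by rewrite sb col_mxKd col_mxKu lift_max_cur.
  by rewrite /stack !col_mxKd.
- by rewrite /u_of sb !col_mxKd.
Qed.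

Lemma unstackK (R : realType) (N nx nu p : nat) (z : 'M[R]_(nz N nx nu, p)) :
  stack (lam_of z) (x_of z) (u_of z) = z.
Proof.
rewrite /stack -[RHS](vsubmxK z); congr col_mx; last first.
  by rewrite /lam_of /x_of unlift_none vsubmxK.
rewrite -[RHS]submxcolK; apply: eq_mxcol => k.
by rewrite /lam_of /x_of -lift_max_cur liftK /u_of !vsubmxK.
Qed.

Definition lagrangian_z (R : realType) (N nx nu nth : nat)
    (P : ocp R nx nu nth) (z : 'cV[R]_(nz N nx nu)) (th : 'cV[R]_nth) : R :=
  lagrangian P (lam_of z) (x_of z) (u_of z) th.

Definition grad_z (R : realType) (N nx nu nth : nat)
    (P : ocp R nx nu nth) (z : 'cV[R]_(nz N nx nu)) (th : 'cV[R]_nth)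
    : 'cV[R]_(nz N nx nu) :=
  grad (fun y => lagrangian_z P y th) z.

Definition L_zz (R : realType) (N nx nu nth : nat)
    (P : ocp R nx nu nth) (z : 'cV[R]_(nz N nx nu)) (th : 'cV[R]_nth)
    : 'M[R]_(nz N nx nu) :=
  Jac (fun y => grad_z P y th) z.

Definition L_zth (R : realType) (N nx nu nth : nat)
    (P : ocp R nx nu nth) (z : 'cV[R]_(nz N nx nu)) (th : 'cV[R]_nth)
    : 'M[R]_(nz N nx nu, nth) :=
  Jac (fun t => grad_z P z t) th.

(* Gradients and second derivatives of the full Lagrangian in x_k, u_k, theta;
   [eta x with cur k |-> a] is x with its entry x_k replaced by a. *)
Definition grad_x (R : realType) (N nx nu nth : nat) (P : ocp R nx nu nth)
    (lam x : 'I_N.+1 -> 'cV[R]_nx) (u : 'I_N -> 'cV[R]_nu) (th : 'cV[R]_nth)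
    (k : 'I_N) : 'cV[R]_nx :=
  grad (fun a => lagrangian P lam [eta x with cur k |-> a] u th) (x (cur k)).

Definition grad_u (R : realType) (N nx nu nth : nat) (P : ocp R nx nu nth)
    (lam x : 'I_N.+1 -> 'cV[R]_nx) (u : 'I_N -> 'cV[R]_nu) (th : 'cV[R]_nth)
    (k : 'I_N) : 'cV[R]_nu :=
  grad (fun a => lagrangian P lam x [eta u with k |-> a] th) (u k).

Definition L_xx (R : realType) (N nx nu nth : nat) (P : ocp R nx nu nth)
    (lam x : 'I_N.+1 -> 'cV[R]_nx) (u : 'I_N -> 'cV[R]_nu) (th : 'cV[R]_nth)
    (k : 'I_N) : 'M[R]_nx :=
  Jac (fun a => grad_x P lam [eta x with cur k |-> a] u th k) (x (cur k)).

Definition L_xu (R : realType) (N nx nu nth : nat) (P : ocp R nx nu nth)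
    (lam x : 'I_N.+1 -> 'cV[R]_nx) (u : 'I_N -> 'cV[R]_nu) (th : 'cV[R]_nth)
    (k : 'I_N) : 'M[R]_(nx, nu) :=
  Jac (fun a => grad_x P lam x [eta u with k |-> a] th k) (u k).

Definition L_xth (R : realType) (N nx nu nth : nat) (P : ocp R nx nu nth)
    (lam x : 'I_N.+1 -> 'cV[R]_nx) (u : 'I_N -> 'cV[R]_nu) (th : 'cV[R]_nth)
    (k : 'I_N) : 'M[R]_(nx, nth) :=
  Jac (fun t => grad_x P lam x u t k) th.

Definition L_ux (R : realType) (N nx nu nth : nat) (P : ocp R nx nu nth)
    (lam x : 'I_N.+1 -> 'cV[R]_nx) (u : 'I_N -> 'cV[R]_nu) (th : 'cV[R]_nth)
    (k : 'I_N) : 'M[R]_(nu, nx) :=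
  Jac (fun a => grad_u P lam [eta x with cur k |-> a] u th k) (x (cur k)).

Definition L_uu (R : realType) (N nx nu nth : nat) (P : ocp R nx nu nth)
    (lam x : 'I_N.+1 -> 'cV[R]_nx) (u : 'I_N -> 'cV[R]_nu) (th : 'cV[R]_nth)
    (k : 'I_N) : 'M[R]_nu :=
  Jac (fun a => grad_u P lam x [eta u with k |-> a] th k) (u k).

Definition L_uth (R : realType) (N nx nu nth : nat) (P : ocp R nx nu nth)
    (lam x : 'I_N.+1 -> 'cV[R]_nx) (u : 'I_N -> 'cV[R]_nu) (th : 'cV[R]_nth)
    (k : 'I_N) : 'M[R]_(nu, nth) :=
  Jac (fun t => grad_u P lam x u t k) th.

Definition f_x (R : realType) (nx nu nth : nat) (P : ocp R nx nu nth)
    (x : 'cV[R]_nx) (u : 'cV[R]_nu) (th : 'cV[R]_nth) : 'M[R]_nx :=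
  Jac (fun a => dyn P (a, u, th)) x.

Definition f_u (R : realType) (nx nu nth : nat) (P : ocp R nx nu nth)
    (x : 'cV[R]_nx) (u : 'cV[R]_nu) (th : 'cV[R]_nth) : 'M[R]_(nx, nu) :=
  Jac (fun a => dyn P (x, a, th)) u.

Definition f_th (R : realType) (nx nu nth : nat) (P : ocp R nx nu nth)
    (x : 'cV[R]_nx) (u : 'cV[R]_nu) (th : 'cV[R]_nth) : 'M[R]_(nx, nth) :=
  Jac (fun t => dyn P (x, u, t)) th.

Definition phi_xx (R : realType) (nx nu nth : nat) (P : ocp R nx nu nth)
    (x : 'cV[R]_nx) (th : 'cV[R]_nth) : 'M[R]_nx :=
  Jac (fun a => grad (fun b => final_cost P (b, th)) a) x.

Definition phi_xth (R : realType) (nx nu nth : nat) (P : ocp R nx nu nth)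
    (x : 'cV[R]_nx) (th : 'cV[R]_nth) : 'M[R]_(nx, nth) :=
  Jac (fun t => grad (fun b => final_cost P (b, t)) x) th.

Definition diff_pontryagin (R : realType) (N nx nu nth : nat)
    (P : ocp R nx nu nth) (lam x : 'I_N.+1 -> 'cV[R]_nx)
    (u : 'I_N -> 'cV[R]_nu) (th : 'cV[R]_nth)
    (dlam dx : 'I_N.+1 -> 'M[R]_(nx, nth)) (du : 'I_N -> 'M[R]_(nu, nth))
    : Prop :=
  [/\ dx ord0 = Jac (init P) th,
      forall k : 'I_N,
        dx (nxt k) = f_x P (x (cur k)) (u k) th *m dx (cur k)
                     + f_u P (x (cur k)) (u k) th *m du k
                     + f_th P (x (cur k)) (u k) th,
      forall k : 'I_N,
        dlam (cur k) = L_xx P lam x u th k *m dx (cur k)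
                       + L_xu P lam x u th k *m du k
                       + (f_x P (x (cur k)) (u k) th)^T *m dlam (nxt k)
                       + L_xth P lam x u th k,
      forall k : 'I_N,
        0 = L_ux P lam x u th k *m dx (cur k)
            + L_uu P lam x u th k *m du k
            + (f_u P (x (cur k)) (u k) th)^T *m dlam (nxt k)
            + L_uth P lam x u th k
    & dlam ord_max = phi_xx P (x ord_max) th *m dx ord_max
                     + phi_xth P (x ord_max) th].

(* Main.v *)
Require Import Defs.
From HB Require Import structures.
From mathcomp Require Import all_boot all_order all_algebra.
From mathcomp Require Import all_classical all_reals all_analysis.
From mathcomp Require Import ring.
Import Order.TTheory GRing.Theory Num.Theory.
Import numFieldNormedType.Exports.
Local Open Scope classical_set_scope.
Local Open Scope ring_scope.

Set Implicit Arguments.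
Unset Strict Implicit.
Unset Printing Implicit Defensive.

(** Since L_zz is invertible, dz = - L_zz^-1 L_zth means L_zz dz + L_zth = 0,
    and the five Pontryagin equations are the block rows of this matrix
    equation: the row of lam_0 is the initial condition, that of lam_(k+1) the
    linearized dynamics, those of x_k and u_k the adjoint and the stationarity
    equations, and that of x_N the terminal condition.

    The Lagrangian can be grouped in two ways. Grouped by multipliers
    ([lagrangian_defect]) it is linear in lam_k, with the constraint defect as
    coefficient, so the lam_k-gradient is that defect. Grouped by states and
    controls ([lagrangian_hamiltonian]) it is a sum of Hamiltonians
    l + lam_(k+1)^T f, of the terms - lam_k^T x_k, and of the boundary terms, so
    the gradient in x_k (resp. u_k) involves only x_k, u_k, lam_(k+1), and
    lam_k (resp. x_k, u_k, lam_(k+1)). Hence each block row of L_zz has at most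
    four nonzero blocks, each of them a Jacobian from the Pontryagin equations,
    the transpose of one, or minus the identity.

    No chain rule on the space of stacked vectors is required. The entries of
    gradients and Jacobians are directional derivatives along basis vectors of
    that space, and moving along one of these moves a single lam_k, x_k or u_k
    along a basis vector. So the blocks of a gradient are partial gradients
    ([lam_of_grad], [x_of_grad], [u_of_grad]), and a Jacobian times a stacked
    matrix is a sum of partial Jacobians times blocks ([Jac_stack]). The only
    analytic input left is the differentiability of the dynamics and the costs,
    which allows the sums l + lam^T f and phi - lam^T x to be differentiated
    term by term. *)

(** * Directional derivatives, gradients and Jacobians *)

(** A directional derivative depends only on the increments along a line. This
    one fact discards additive constants, and also transports a derivative
    along a basis vector of the stacked space to one along a basis vector of a
    single block. *)
Lemma derive_incr (R : realType) (V V' W : normedModType R)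
    (f : V -> W) (g : V' -> W) (a v : V) (b w : V') :
  (forall h, f (h *: v + a) - f a = g (h *: w + b) - g b) ->
  'D_v f a = 'D_w g b.
Proof.
move=> fg; rewrite /derive.
suff -> : (fun h => h^-1 *: ((f \o shift a) (h *: v) - f a)) =
  (fun h => h^-1 *: ((g \o shift b) (h *: w) - g b)) by [].
by apply/funext => h /=; rewrite fg.
Qed.

Lemma derivable_incr (R : realType) (V V' W : normedModType R)
    (f : V -> W) (g : V' -> W) (a v : V) (b w : V') :
  (forall h, f (h *: v + a) - f a = g (h *: w + b) - g b) ->
  derivable g b w -> derivable f a v.
Proof.
move=> fg; rewrite /derivable.
suff -> : (fun h => h^-1 *: ((f \o shift a) (h *: v) - f a)) =
  (fun h => h^-1 *: ((g \o shift b) (h *: w) - g b)) by [].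
by apply/funext => h /=; rewrite fg.
Qed.

Lemma derive_affine (R : realType) (V : normedModType R)
    (f : V -> R) (a v : V) (c : R) :
  (forall h, f (h *: v + a) = f a + h * c) -> 'D_v f a = c.
Proof.
move=> fE; rewrite (@derive_incr R V R^o R^o f id a v 0 c) ?derive_id// => h.
by rewrite fE addr0 subr0 addrC addKr.
Qed.

Lemma eq_grad (R : realType) (n : nat) (f g : 'cV[R]_n -> R) a :
  f =1 g -> grad f a = grad g a.
Proof. by move=> /funext ->. Qed.

Lemma eq_Jac (R : realType) (m n : nat) (F G : 'cV[R]_n -> 'cV[R]_m) a :
  F =1 G -> Jac F a = Jac G a.
Proof. by move=> /funext ->. Qed.

Lemma Jac_incr (R : realType) (m n : nat)
    (F G : 'cV[R]_n -> 'cV[R]_m) (a : 'cV[R]_n) (c : 'cV[R]_m) :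
  (forall b, F b = G b + c) -> Jac F a = Jac G a.
Proof.
move=> FG; apply/matrixP => i j; rewrite !mxE; apply: derive_incr => h.
by rewrite !FG !mxE opprD addrACA subrr addr0.
Qed.

Lemma Jac_cst (R : realType) (m n : nat)
    (F : 'cV[R]_n -> 'cV[R]_m) (a : 'cV[R]_n) (c : 'cV[R]_m) :
  (forall b, F b = c) -> Jac F a = 0.
Proof.
move=> Fc; apply/matrixP => i j; rewrite !mxE.
by apply: derive_affine => h; rewrite !Fc mulr0 addr0.
Qed.

Lemma Jac_affine (R : realType) (m n : nat) (F : 'cV[R]_n -> 'cV[R]_m)
    (A : 'M[R]_(m, n)) (a : 'cV[R]_n) (c : 'cV[R]_m) :
  (forall b, F b = A *m b + c) -> Jac F a = A.
Proof.
move=> FE; apply/matrixP => i j; rewrite !mxE; apply: derive_affine => h.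
by rewrite !FE mulmxDr -scalemxAr -colE !mxE -addrA addrC.
Qed.

Lemma grad_incr (R : realType) (n : nat) (f g : 'cV[R]_n -> R) (a : 'cV[R]_n) c :
  (forall b, f b = g b + c) -> grad f a = grad g a.
Proof.
move=> fg; apply/matrixP => i j; rewrite !mxE; apply: derive_incr => h.
by rewrite !fg opprD addrACA subrr addr0.
Qed.

Lemma grad_linear (R : realType) (n : nat) (c : R) (v a : 'cV[R]_n) f :
  (forall b, f b = (v^T *m b) 0 0 + c) -> grad f a = v.
Proof.
move=> fE; apply/matrixP => i j; rewrite !mxE ord1; apply: derive_affine => h.
by rewrite !fE mulmxDr -scalemxAr -colE !mxE -addrA addrC.
Qed.

Lemma dotC (R : realType) (n : nat) (a b : 'cV[R]_n) :
  (a^T *m b) 0 0 = (b^T *m a) 0 0.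
Proof. by rewrite !mxE; apply: eq_bigr => i _; rewrite !mxE mulrC. Qed.

(** Differentiates the Hamiltonian l + lam^T f in the state or the control;
    with F the identity it also covers the terms lam^T x. *)
Lemma is_derive_add_dot (R : realType) (V : normedModType R) (m : nat) (g : V -> R)
    (F : V -> 'cV[R]_m) (b : 'cV[R]_m) (a v : V) :
  derivable g a v -> derivable F a v ->
  is_derive a v (fun y => g y + (b^T *m F y) 0 0)
    ('D_v g a + \sum_k 'D_v (fun y => F y k 0) a * b k 0).
Proof.
move=> dg dF.
have dFk k : derivable (fun y => F y k 0) a v by exact: (derivable_mxP _ _ _).1 dF k 0.
pose h (k : 'I_m) := b k 0 \*: (fun y => F y k 0 : R^o).
have -> : (fun y => g y + (b^T *m F y) 0 0) = (g : _ -> R^o) + \sum_k h k.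
  apply/funext => y; rewrite fctE fct_sumE !mxE; congr (_ + _).
  by apply: eq_bigr => k _; rewrite !mxE.
have dh k : derivable (h k) a v by apply: derivableZ.
split; first by apply: derivableD => //; exact: derivable_sum.
rewrite deriveD ?derive_sum//; last exact: derivable_sum.
by congr (_ + _); apply: eq_bigr => k _; rewrite deriveZ// mulrC.
Qed.

Lemma grad_add_dot (R : realType) (m n : nat) (g : 'cV[R]_n -> R)
    (F : 'cV[R]_n -> 'cV[R]_m) (b : 'cV[R]_m) (a : 'cV[R]_n) :
  (forall v, derivable g a v) -> (forall v, derivable F a v) ->
  grad (fun y => g y + (b^T *m F y) 0 0) a = grad g a + (Jac F a)^T *m b.
Proof.
move=> dg dF; apply/matrixP => i j; rewrite !mxE ord1.
have [_ ->] := is_derive_add_dot b (dg (delta_mx i 0)) (dF (delta_mx i 0)).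
by congr (_ + _); apply: eq_bigr => k _; rewrite !mxE.
Qed.

Lemma grad_sub_dot (R : realType) (n : nat) (f g : 'cV[R]_n -> R)
    (b : 'cV[R]_n) (c : R) (a : 'cV[R]_n) :
  (forall v, derivable g a v) ->
  (forall y, f y = g y - (b^T *m y) 0 0 + c) -> grad f a = grad g a - b.
Proof.
move=> dg fE.
rewrite (@grad_incr _ _ f (fun y => g y + ((- b)^T *m y) 0 0) a c); last first.
  by move=> y; rewrite fE linearN mulNmx [in RHS]mxE.
rewrite (@grad_add_dot _ _ _ g id)//.
by rewrite (@Jac_affine _ _ _ _ 1%:M _ 0) ?trmx1 ?mul1mx// => y; rewrite mul1mx addr0.
Qed.

(** * Coordinates of stacked vectors *)

Section Stack.
Context (R : realType) (N nx nu : nat).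
Local Notation nz := (nz N nx nu).

(** The scalar unknowns, labelled by their stage and their place in it: the
    multipliers, then the states, then the controls. *)
Definition slot := ('I_N.+1 * 'I_nx + 'I_N.+1 * 'I_nx + 'I_N * 'I_nu)%type.

Definition pos (s : slot) : 'I_nz :=
  let blk (k : 'I_N) i :=
    lshift (nx + nx) (tagnat.Rank (p_ := fun=> (nx + (nx + nu))%N) k i) in
  match s with
  | inl (inl (k, i)) =>
      if unlift ord_max k is Some j then blk j (lshift (nx + nu) i)
      else rshift _ (lshift nx i)
  | inl (inr (k, i)) =>
      if unlift ord_max k is Some j then blk j (rshift nx (lshift nu i))
      else rshift _ (rshift nx i)
  | inr (k, i) => blk k (rshift nx (rshift nx i))
  end.

Arguments pos : simpl never.

Definition entry p (lam x : 'I_N.+1 -> 'M[R]_(nx, p)) (u : 'I_N -> 'M[R]_(nu, p))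
    (s : slot) : 'rV[R]_p :=
  match s with
  | inl (inl (k, i)) => row i (lam k)
  | inl (inr (k, i)) => row i (x k)
  | inr (k, i) => row i (u k)
  end.

Lemma row_pos p (z : 'M[R]_(nz, p)) s :
  row (pos s) z = entry (lam_of z) (x_of z) (u_of z) s.
Proof.
apply/rowP => j; case: s => [[] [k i]|[k i]]; rewrite /pos /entry /lam_of /x_of /u_of.
- by case: unliftP => [l _|_]; rewrite !mxE.
- by case: unliftP => [l _|_]; rewrite !mxE.
- by rewrite !mxE.
Qed.

Lemma row_stack p lam x u s :
  row (pos s) (@stack R N nx nu p lam x u) = entry lam x u s.
Proof. by rewrite row_pos; case: (stackK lam x u) => -> -> ->. Qed.

Definition basis (s : slot) : 'cV[R]_nz :=
  stack (fun k => \col_i (inl (inl (k, i)) == s)%:R)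
        (fun k => \col_i (inl (inr (k, i)) == s)%:R)
        (fun k => \col_i (inr (k, i) == s)%:R).

Lemma basis_pos s t : basis s (pos t) 0 = (t == s)%:R.
Proof.
have /rowP/(_ 0) := row_stack (fun k => \col_i (inl (inl (k, i)) == s)%:R)
        (fun k => \col_i (inl (inr (k, i)) == s)%:R)
        (fun k => \col_i (inr (k, i) == s)%:R) t.
by rewrite mxE => ->; case: t => [[] [k i]|[k i]] /=; rewrite !mxE.
Qed.

Lemma row_basis s t : row (pos t) (basis s) = const_mx (t == s)%:R.
Proof. by apply/rowP => j; rewrite ord1 [LHS]mxE basis_pos mxE. Qed.

(** Two labels with the same position would have the same value in every stacked
    vector, but [basis s] is 1 at [s] and 0 at all other labels. *)
Lemma pos_inj : injective pos.
Proof.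
move=> s t st; apply/esym/eqP; have := basis_pos s t.
by rewrite -st basis_pos eqxx; case: eqP => // _ /eqP; rewrite oner_eq0.
Qed.

Lemma eq_by_slots p (A B : 'M[R]_(nz, p)) :
  (forall s, row (pos s) A = row (pos s) B) -> A = B.
Proof.
move=> AB; rewrite -(unstackK A) -(unstackK B).
have AB' s : entry (lam_of A) (x_of A) (u_of A) s = entry (lam_of B) (x_of B) (u_of B) s.
  by rewrite -!row_pos AB.
congr stack; apply/funext => k; apply/row_matrixP => i.
- exact: (AB' (inl (inl (k, i)))).
- exact: (AB' (inl (inr (k, i)))).
- exact: (AB' (inr (k, i))).
Qed.

Lemma basisE s : basis s = delta_mx (pos s) 0.
Proof.
apply: eq_by_slots => t; apply/rowP => j; rewrite ord1 [LHS]mxE basis_pos !mxE.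
by rewrite (inj_eq pos_inj) eqxx andbT.
Qed.

(** A position without a label would carry a basis vector all of whose blocks
    vanish, although a stacked vector is determined by its blocks. *)
Lemma pos_bij : bijective pos.
Proof.
have surj i : exists s, pos s = i.
  apply: contrapT => /forallNP ni.
  have : delta_mx i 0 = 0 :> 'cV[R]_nz.
    apply: eq_by_slots => s; apply/rowP => j; rewrite !mxE.
    by case: eqP => [/ni|].
  by move/matrixP/(_ i 0)/eqP; rewrite !mxE !eqxx oner_eq0.
exists (fun i => sval (cid (surj i))) => [s|i]; last by case: cid.
by apply: pos_inj; case: cid.
Qed.

Lemma sum_pos (F : 'I_nz -> R) :
  \sum_i F i = \sum_k \sum_i F (pos (inl (inl (k, i))))
    + \sum_k \sum_i F (pos (inl (inr (k, i)))) + \sum_k \sum_i F (pos (inr (k, i))).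
Proof.
rewrite (reindex pos) /=; last exact: onW_bij pos_bij.
by rewrite !big_sumType /= !pair_bigA; congr (_ + _ + _); apply: eq_bigr => -[].
Qed.

(** Moving along a basis vector of the stacked space moves a single block along
    a basis vector of its own space. *)
Lemma stack_lam (lam x : 'I_N.+1 -> 'cV[R]_nx) (u : 'I_N -> 'cV[R]_nu) k i h :
  h *: basis (inl (inl (k, i))) + stack lam x u
  = stack [eta lam with k |-> h *: delta_mx i 0 + lam k] x u.
Proof.
apply: eq_by_slots => s; apply/rowP => j; rewrite linearD linearZ /= row_basis.
rewrite !row_stack !mxE ord1.
case: s => [[] [l m]|[l m]] /=; rewrite ?mulr0 ?add0r //.
rewrite (inj_eq inl_inj) (inj_eq inl_inj) xpair_eqE.
by case: (eqVneq l k) => [->|lk]; rewrite !mxE ?andbT //= mulr0 add0r.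
Qed.

Lemma stack_x (lam x : 'I_N.+1 -> 'cV[R]_nx) (u : 'I_N -> 'cV[R]_nu) k i h :
  h *: basis (inl (inr (k, i))) + stack lam x u
  = stack lam [eta x with k |-> h *: delta_mx i 0 + x k] u.
Proof.
apply: eq_by_slots => s; apply/rowP => j; rewrite linearD linearZ /= row_basis.
rewrite !row_stack !mxE ord1.
case: s => [[] [l m]|[l m]] /=; rewrite ?mulr0 ?add0r //.
rewrite (inj_eq inl_inj) (inj_eq inr_inj) xpair_eqE.
by case: (eqVneq l k) => [->|lk]; rewrite !mxE ?andbT //= mulr0 add0r.
Qed.

Lemma stack_u (lam x : 'I_N.+1 -> 'cV[R]_nx) (u : 'I_N -> 'cV[R]_nu) k i h :
  h *: basis (inr (k, i)) + stack lam x u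
  = stack lam x [eta u with k |-> h *: delta_mx i 0 + u k].
Proof.
apply: eq_by_slots => s; apply/rowP => j; rewrite linearD linearZ /= row_basis.
rewrite !row_stack !mxE ord1.
case: s => [[] [l m]|[l m]] /=; rewrite ?mulr0 ?add0r //.
rewrite (inj_eq inr_inj) xpair_eqE.
by case: (eqVneq l k) => [->|lk]; rewrite !mxE ?andbT //= mulr0 add0r.
Qed.

Section Partials.
Context (lam x : 'I_N.+1 -> 'cV[R]_nx) (u : 'I_N -> 'cV[R]_nu).

Lemma fun_delta_id (I : eqType) T (f : I -> T) k : [eta f with k |-> f k] = f :> (I -> T).
Proof. by apply/funext => l /=; case: eqP => [->|]. Qed.

Lemma lam_of_grad (g : 'cV[R]_nz -> R) k :
  lam_of (grad g (stack lam x u)) k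
  = grad (fun a => g (stack [eta lam with k |-> a] x u)) (lam k).
Proof.
apply/row_matrixP => i.
have /= <- := row_pos (grad g (stack lam x u)) (inl (inl (k, i))).
apply/rowP => j; rewrite !mxE -basisE; apply: derive_incr => h.
by rewrite stack_lam fun_delta_id.
Qed.

Lemma x_of_grad (g : 'cV[R]_nz -> R) k :
  x_of (grad g (stack lam x u)) k
  = grad (fun a => g (stack lam [eta x with k |-> a] u)) (x k).
Proof.
apply/row_matrixP => i.
have /= <- := row_pos (grad g (stack lam x u)) (inl (inr (k, i))).
apply/rowP => j; rewrite !mxE -basisE; apply: derive_incr => h.
by rewrite stack_x fun_delta_id.
Qed.

Lemma u_of_grad (g : 'cV[R]_nz -> R) k :
  u_of (grad g (stack lam x u)) k
  = grad (fun a => g (stack lam x [eta u with k |-> a])) (u k).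
Proof.
apply/row_matrixP => i.
have /= <- := row_pos (grad g (stack lam x u)) (inr (k, i)).
apply/rowP => j; rewrite !mxE -basisE; apply: derive_incr => h.
by rewrite stack_u fun_delta_id.
Qed.

(** [G] is the map F expressed in blocks; naming it separately lets each partial
    Jacobian be read off without unstacking. *)
Lemma Jac_stack p m (F : 'cV[R]_nz -> 'cV[R]_m)
    (G : ('I_N.+1 -> 'cV[R]_nx) -> ('I_N.+1 -> 'cV[R]_nx) ->
         ('I_N -> 'cV[R]_nu) -> 'cV[R]_m)
    (dlam dx : 'I_N.+1 -> 'M[R]_(nx, p)) (du : 'I_N -> 'M[R]_(nu, p)) :
  (forall lam x u, F (stack lam x u) = G lam x u) ->
  Jac F (stack lam x u) *m stack dlam dx du =
    \sum_k Jac (fun a => G [eta lam with k |-> a] x u) (lam k) *m dlam k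
  + \sum_k Jac (fun a => G lam [eta x with k |-> a] u) (x k) *m dx k
  + \sum_k Jac (fun a => G lam x [eta u with k |-> a]) (u k) *m du k.
Proof.
move=> FG; apply/matrixP => i j; rewrite !mxE sum_pos !summxE.
have e s : stack dlam dx du (pos s) j = entry dlam dx du s 0 j.
  by rewrite -row_stack [RHS]mxE.
congr (_ + _ + _); apply: eq_bigr => k _; rewrite !mxE; apply: eq_bigr => l _;
  rewrite e !mxE -basisE; congr (_ * _); apply: derive_incr => h.
- by rewrite stack_lam fun_delta_id !FG.
- by rewrite stack_x fun_delta_id !FG.
- by rewrite stack_u fun_delta_id !FG.
Qed.

End Partials.

Section Rows.
Context (p n : nat).

Lemma lam_of_mul (A : 'M[R]_(nz, n)) (B : 'M[R]_(n, p)) k :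
  lam_of (A *m B) k = lam_of A k *m B.
Proof.
apply/row_matrixP => i; rewrite row_mul.
have /= <- := row_pos A (inl (inl (k, i))).
by have /= <- := row_pos (A *m B) (inl (inl (k, i))); rewrite row_mul.
Qed.

Lemma x_of_mul (A : 'M[R]_(nz, n)) (B : 'M[R]_(n, p)) k :
  x_of (A *m B) k = x_of A k *m B.
Proof.
apply/row_matrixP => i; rewrite row_mul.
have /= <- := row_pos A (inl (inr (k, i))).
by have /= <- := row_pos (A *m B) (inl (inr (k, i))); rewrite row_mul.
Qed.

Lemma u_of_mul (A : 'M[R]_(nz, n)) (B : 'M[R]_(n, p)) k :
  u_of (A *m B) k = u_of A k *m B.
Proof.
apply/row_matrixP => i; rewrite row_mul.
have /= <- := row_pos A (inr (k, i)).
by have /= <- := row_pos (A *m B) (inr (k, i)); rewrite row_mul.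
Qed.

Lemma lam_of_Jac (F : 'cV[R]_n -> 'cV[R]_nz) a k :
  lam_of (Jac F a) k = Jac (fun y => lam_of (F y) k) a.
Proof.
apply/row_matrixP => i.
have /= <- := row_pos (Jac F a) (inl (inl (k, i))).
apply/rowP => j; rewrite !mxE; congr ('D_ _ _ _); apply/funext => y.
by have /rowP/(_ 0) := row_pos (F y) (inl (inl (k, i))); rewrite !mxE.
Qed.

Lemma x_of_Jac (F : 'cV[R]_n -> 'cV[R]_nz) a k :
  x_of (Jac F a) k = Jac (fun y => x_of (F y) k) a.
Proof.
apply/row_matrixP => i.
have /= <- := row_pos (Jac F a) (inl (inr (k, i))).
apply/rowP => j; rewrite !mxE; congr ('D_ _ _ _); apply/funext => y.
by have /rowP/(_ 0) := row_pos (F y) (inl (inr (k, i))); rewrite !mxE.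
Qed.

Lemma u_of_Jac (F : 'cV[R]_n -> 'cV[R]_nz) a k :
  u_of (Jac F a) k = Jac (fun y => u_of (F y) k) a.
Proof.
apply/row_matrixP => i.
have /= <- := row_pos (Jac F a) (inr (k, i)).
apply/rowP => j; rewrite !mxE; congr ('D_ _ _ _); apply/funext => y.
by have /rowP/(_ 0) := row_pos (F y) (inr (k, i)); rewrite !mxE.
Qed.

Lemma lam_ofD (A B : 'M[R]_(nz, n)) k : lam_of (A + B) k = lam_of A k + lam_of B k.
Proof.
apply/row_matrixP => i; rewrite linearD /=.
have /= <- := row_pos A (inl (inl (k, i))); have /= <- := row_pos B (inl (inl (k, i))).
by have /= <- := row_pos (A + B) (inl (inl (k, i))); rewrite linearD.
Qed.

Lemma x_ofD (A B : 'M[R]_(nz, n)) k : x_of (A + B) k = x_of A k + x_of B k.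
Proof.
apply/row_matrixP => i; rewrite linearD /=.
have /= <- := row_pos A (inl (inr (k, i))); have /= <- := row_pos B (inl (inr (k, i))).
by have /= <- := row_pos (A + B) (inl (inr (k, i))); rewrite linearD.
Qed.

Lemma u_ofD (A B : 'M[R]_(nz, n)) k : u_of (A + B) k = u_of A k + u_of B k.
Proof.
apply/row_matrixP => i; rewrite linearD /=.
have /= <- := row_pos A (inr (k, i)); have /= <- := row_pos B (inr (k, i)).
by have /= <- := row_pos (A + B) (inr (k, i)); rewrite linearD.
Qed.

End Rows.
End Stack.

(** * Sums with few nonzero terms, and indices of stages *)

Section SparseSum.
Context (R : realType) (I : finType) (m n p : nat).
Implicit Types (J : I -> 'M[R]_(m, n)) (D : I -> 'M[R]_(n, p)) (A B : 'M[R]_(m, n)).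

Lemma sum_mulmx0 J D : (forall k, J k = 0) -> \sum_k J k *m D k = 0.
Proof. by move=> J0; rewrite big1 // => k _; rewrite J0 mul0mx. Qed.

Lemma sum_mulmx1 J D A i :
  J i = A -> (forall k, k != i -> J k = 0) -> \sum_k J k *m D k = A *m D i.
Proof.
by move=> <- J0; rewrite (bigD1 i)//= big1 ?addr0// => k /J0 ->; rewrite mul0mx.
Qed.

Lemma sum_mulmx2 J D A B i j : i != j -> J i = A -> J j = B ->
  (forall k, k != i -> k != j -> J k = 0) ->
  \sum_k J k *m D k = A *m D i + B *m D j.
Proof.
move=> ij <- <- J0; rewrite (bigD1 i)//= (bigD1 j) 1?eq_sym//= big1 ?addr0//.
by move=> k /andP[ki kj]; rewrite J0 ?mul0mx.
Qed.

End SparseSum.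

Lemma cur_inj N : injective (@cur N).
Proof. by move=> k l /(congr1 val) kl; apply: val_inj. Qed.

Lemma cur_neq_max N (k : 'I_N) : cur k != ord_max.
Proof. by rewrite -lift_max_cur eq_sym neq_lift. Qed.

Lemma nxt_neq_cur N (k : 'I_N) : nxt k != cur k.
Proof. by rewrite -val_eqE /= /bump /= add1n -[X in _ != X]addn0 -addn1 eqn_add2l. Qed.

(** * The Lagrangian and the blocks of its gradient *)

Section Lagrangian.
Context (R : realType) (N nx nu nth : nat) (P : ocp R nx nu nth).
Implicit Types (lam x : 'I_N.+1 -> 'cV[R]_nx) (u : 'I_N -> 'cV[R]_nu)
  (th : 'cV[R]_nth).

(** The residual of the constraint that the multiplier lam_k is attached to. *)
Definition defect x u th (k : 'I_N.+1) : 'cV[R]_nx :=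
  (if unlift ord0 k is Some j then dyn P (x (cur j), u j, th) else init P th) - x k.

Lemma defect0 x u th : defect x u th ord0 = init P th - x ord0.
Proof. by rewrite /defect unlift_none. Qed.

Lemma defect_nxt x u th k :
  defect x u th (nxt k) = dyn P (x (cur k), u k, th) - x (nxt k).
Proof. by rewrite /defect liftK. Qed.

Definition hamiltonian th (l x : 'cV[R]_nx) (u : 'cV[R]_nu) : R :=
  stage_cost P (x, u, th) + (l^T *m dyn P (x, u, th)) 0 0.

(** Each multiplier occurs here in a single term, linearly. *)
Lemma lagrangian_defect lam x u th :
  lagrangian P lam x u th = \sum_k ((lam k)^T *m defect x u th k) 0 0
    + (\sum_k stage_cost P (x (cur k), u k, th) + final_cost P (x ord_max, th)).
Proof.
rewrite /lagrangian big_split /=.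
under [X in _ + X + _ + _]eq_bigr do rewrite -defect_nxt.
by rewrite -(defect0 x u) big_ord_recl; ring.
Qed.

(** The terms - lam_(k+1)^T x_(k+1) and - lam_0^T x_0 are gathered into one sum
    over all stages, so that each x_k occurs in a single Hamiltonian and in a
    single bilinear term. *)
Lemma lagrangian_hamiltonian lam x u th :
  lagrangian P lam x u th =
    \sum_k hamiltonian th (lam (nxt k)) (x (cur k)) (u k)
    - \sum_k ((lam k)^T *m x k) 0 0 + final_cost P (x ord_max, th)
    + ((lam ord0)^T *m init P th) 0 0.
Proof.
have mulB (l a b : 'cV[R]_nx) : (l^T *m (a - b)) 0 0 = (l^T *m a) 0 0 - (l^T *m b) 0 0.
  by rewrite mulmxBr !mxE.
rewrite /lagrangian big_ord_recl mulB.
under eq_bigr do rewrite mulB addrA.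
rewrite sumrB; ring.
Qed.

Lemma lagrangian_lam lam x u th k : exists c, forall a,
  lagrangian P [eta lam with k |-> a] x u th = ((defect x u th k)^T *m a) 0 0 + c.
Proof.
eexists => a; rewrite lagrangian_defect (bigD1 k)//= eqxx dotC -addrA.
congr (_ + (_ + _)).
by apply: eq_bigr => l /negbTE ->.
Qed.

Lemma lagrangian_x lam x u th k : exists c, forall a,
  lagrangian P lam [eta x with cur k |-> a] u th =
    hamiltonian th (lam (nxt k)) a (u k) - ((lam (cur k))^T *m a) 0 0 + c.
Proof.
pose s := \sum_(l | l != k) hamiltonian th (lam (nxt l)) (x (cur l)) (u l).
pose t := \sum_(l | l != cur k) ((lam l)^T *m x l) 0 0.
exists (s - t + final_cost P (x ord_max, th) + ((lam ord0)^T *m init P th) 0 0) => a.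
rewrite lagrangian_hamiltonian (bigD1 k)//= [in X in _ - X](bigD1 (cur k))//= !eqxx.
rewrite eq_sym (negbTE (cur_neq_max k)) /s /t.
under eq_bigr => l lk do rewrite (inj_eq (@cur_inj N)) (negbTE lk).
under [in X in _ - X]eq_bigr => l lk do rewrite (negbTE lk).
by ring.
Qed.

Lemma lagrangian_x_max lam x u th : exists c, forall a,
  lagrangian P lam [eta x with ord_max |-> a] u th =
    final_cost P (a, th) - ((lam ord_max)^T *m a) 0 0 + c.
Proof.
pose s := \sum_l hamiltonian th (lam (nxt l)) (x (cur l)) (u l).
pose t := \sum_(l | l != ord_max) ((lam l)^T *m x l) 0 0.
exists (s - t + ((lam ord0)^T *m init P th) 0 0) => a.
rewrite lagrangian_hamiltonian [in X in _ - X](bigD1 ord_max)//= !eqxx /s /t.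
under eq_bigr => l _ do rewrite (negbTE (cur_neq_max l)).
under [in X in _ - X]eq_bigr => l lk do rewrite (negbTE lk).
by ring.
Qed.

Lemma lagrangian_u lam x u th k : exists c, forall a,
  lagrangian P lam x [eta u with k |-> a] th =
    hamiltonian th (lam (nxt k)) (x (cur k)) a + c.
Proof.
eexists => a; rewrite lagrangian_hamiltonian (bigD1 k)//= eqxx.
under eq_bigr => l lk do rewrite (negbTE lk).
by rewrite -!addrA.
Qed.

Lemma lam_of_grad_z lam x u th k :
  lam_of (grad_z P (stack lam x u) th) k = defect x u th k.
Proof.
rewrite /grad_z lam_of_grad; have [c cE] := lagrangian_lam lam x u th k.
apply: (@grad_linear _ _ c) => a; rewrite /lagrangian_z.
by have [-> -> ->] := stackK [eta lam with k |-> a] x u.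
Qed.

Lemma x_of_grad_z lam x u th k :
  x_of (grad_z P (stack lam x u) th) (cur k) = grad_x P lam x u th k.
Proof.
rewrite /grad_z x_of_grad /grad_x; apply: eq_grad => a; rewrite /lagrangian_z.
by have [-> -> ->] := stackK lam [eta x with cur k |-> a] u.
Qed.

Lemma u_of_grad_z lam x u th k :
  u_of (grad_z P (stack lam x u) th) k = grad_u P lam x u th k.
Proof.
rewrite /grad_z u_of_grad /grad_u; apply: eq_grad => a; rewrite /lagrangian_z.
by have [-> -> ->] := stackK lam x [eta u with k |-> a].
Qed.

Context (dyn_diff : forall y, differentiable (dyn P) y)
  (cost_diff : forall y, differentiable (stage_cost P) y)
  (final_diff : forall y, differentiable (final_cost P) y).

Lemma derivable_in_x (W : normedModType R) (g : 'cV[R]_nx * 'cV[R]_nu * 'cV[R]_nth -> W)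
    (x : 'cV[R]_nx) (u : 'cV[R]_nu) (th : 'cV[R]_nth) v :
  differentiable g (x, u, th) -> derivable (fun a => g (a, u, th)) x v.
Proof.
move=> dg; apply: (@derivable_incr _ _ _ _ _ g _ _ (x, u, th) (v, 0, 0));
  last exact: diff_derivable.
move=> h; congr (_ - _).
have -> : h *: (v, 0, 0) + (x, u, th) = (h *: v + x, h *: 0 + u, h *: 0 + th) by [].
by rewrite !scaler0 !add0r.
Qed.

Lemma derivable_in_u (W : normedModType R) (g : 'cV[R]_nx * 'cV[R]_nu * 'cV[R]_nth -> W)
    (x : 'cV[R]_nx) (u : 'cV[R]_nu) (th : 'cV[R]_nth) v :
  differentiable g (x, u, th) -> derivable (fun a => g (x, a, th)) u v.
Proof.
move=> dg; apply: (@derivable_incr _ _ _ _ _ g _ _ (x, u, th) (0, v, 0));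
  last exact: diff_derivable.
move=> h; congr (_ - _).
have -> : h *: (0, v, 0) + (x, u, th) = (h *: 0 + x, h *: v + u, h *: 0 + th) by [].
by rewrite !scaler0 !add0r.
Qed.

(** Shows which unknowns the x_k-gradient depends on: it is affine in lam_(k+1)
    and lam_k, and involves no other stage. This gives every block of its row
    of the Hessian except the two defined through [grad_x] itself. *)
Lemma grad_xE lam x u th k :
  grad_x P lam x u th k = grad (fun a => stage_cost P (a, u k, th)) (x (cur k))
    + (f_x P (x (cur k)) (u k) th)^T *m lam (nxt k) - lam (cur k).
Proof.
have dl v : derivable (fun a => stage_cost P (a, u k, th)) (x (cur k)) v.
  exact: derivable_in_x.
have df v : derivable (fun a => dyn P (a, u k, th)) (x (cur k)) v.
  exact: derivable_in_x.
have [c cE] := lagrangian_x lam x u th k.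
rewrite /grad_x (grad_sub_dot _ cE) ?grad_add_dot// => v.
by have [] := is_derive_add_dot (lam (nxt k)) (dl v) (df v).
Qed.

Lemma grad_uE lam x u th k :
  grad_u P lam x u th k = grad (fun a => stage_cost P (x (cur k), a, th)) (u k)
    + (f_u P (x (cur k)) (u k) th)^T *m lam (nxt k).
Proof.
have [c cE] := lagrangian_u lam x u th k.
by rewrite /grad_u (grad_incr _ cE) grad_add_dot// => v; exact: derivable_in_u.
Qed.

Lemma x_of_grad_z_max lam x u th :
  x_of (grad_z P (stack lam x u) th) ord_max
  = grad (fun b => final_cost P (b, th)) (x ord_max) - lam ord_max.
Proof.
have [c cE] := lagrangian_x_max lam x u th.
rewrite /grad_z x_of_grad; apply: (grad_sub_dot (c := c)) => [v|a].
  apply: (derivable_incr (b := (x ord_max, th)) (w := (v, 0)));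
    last exact: diff_derivable.
  move=> h; congr (_ - _).
  have -> : h *: (v, 0) + (x ord_max, th) = (h *: v + x ord_max, h *: 0 + th) by [].
  by rewrite scaler0 add0r.
rewrite /lagrangian_z -cE.
by have [-> -> ->] := stackK lam [eta x with ord_max |-> a] u.
Qed.

(** * Block rows of the Hessian *)

Section Rows.
Context (lam x : 'I_N.+1 -> 'cV[R]_nx) (u : 'I_N -> 'cV[R]_nu) (th : 'cV[R]_nth)
  (p : nat) (dlam dx : 'I_N.+1 -> 'M[R]_(nx, p)) (du : 'I_N -> 'M[R]_(nu, p)).
Let z := stack lam x u.
Let dz := stack dlam dx du.

Lemma row_lam0 : lam_of (L_zz P z th *m dz) ord0 = - dx ord0.
Proof.
rewrite lam_of_mul lam_of_Jac.
rewrite (Jac_stack _ _ _ _ _ _ (fun l y w => lam_of_grad_z l y w th ord0)).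
transitivity (0 + (- 1%:M) *m dx ord0 + 0); last by rewrite addr0 add0r mulNmx mul1mx.
congr (_ + _ + _).
- by apply: sum_mulmx0 => l; apply: Jac_cst.
- apply: sum_mulmx1 => [|l /negbTE l0].
    apply: (Jac_affine _ (c := init P th)) => b.
    by rewrite defect0 /= mulNmx mul1mx addrC.
  by apply: (Jac_cst _ (c := defect x u th ord0)) => b; rewrite !defect0 /= eq_sym l0.
- apply: sum_mulmx0 => l.
  by apply: (Jac_cst _ (c := defect x u th ord0)) => b; rewrite !defect0.
Qed.

Lemma row_lam_nxt k : lam_of (L_zz P z th *m dz) (nxt k) =
  f_x P (x (cur k)) (u k) th *m dx (cur k) + f_u P (x (cur k)) (u k) th *m du k
  - dx (nxt k).
Proof.
rewrite lam_of_mul lam_of_Jac.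
rewrite (Jac_stack _ _ _ _ _ _ (fun l y w => lam_of_grad_z l y w th (nxt k))).
have nk := nxt_neq_cur k.
transitivity (0 + (f_x P (x (cur k)) (u k) th *m dx (cur k) + (- 1%:M) *m dx (nxt k))
  + f_u P (x (cur k)) (u k) th *m du k); last by rewrite add0r mulNmx mul1mx addrAC.
congr (_ + _ + _).
- by apply: sum_mulmx0 => l; apply: Jac_cst.
- apply: sum_mulmx2 => [|||l lc ln]; first by rewrite eq_sym.
  + apply: (Jac_incr _ (c := - x (nxt k))) => b.
    by rewrite defect_nxt /= eqxx (negbTE nk).
  + apply: (Jac_affine _ (c := dyn P (x (cur k), u k, th))) => b.
    by rewrite defect_nxt /= eqxx eq_sym (negbTE nk) mulNmx mul1mx addrC.
  + apply: (Jac_cst _ (c := defect x u th (nxt k))) => b.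
    by rewrite !defect_nxt /= ![_ == l]eq_sym (negbTE lc) (negbTE ln).
- apply: sum_mulmx1 => [|l /negbTE lk].
    apply: (Jac_incr _ (c := - x (nxt k))) => b.
    by rewrite defect_nxt /= eqxx.
  apply: (Jac_cst _ (c := defect x u th (nxt k))) => b.
  by rewrite !defect_nxt /= eq_sym lk.
Qed.

(** The blocks of lam_(k+1) and lam_k come from the affine form of the
    x_k-gradient ([grad_xE]); those of x_k and u_k are L_xx and L_xu by
    definition, since perturbing a block of the stacked vector is perturbing
    that entry of the trajectory. *)
Lemma row_x_cur k : x_of (L_zz P z th *m dz) (cur k) =
  L_xx P lam x u th k *m dx (cur k) + L_xu P lam x u th k *m du k
  + (f_x P (x (cur k)) (u k) th)^T *m dlam (nxt k) - dlam (cur k).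
Proof.
rewrite x_of_mul x_of_Jac.
rewrite (Jac_stack _ _ _ _ _ _ (fun l y w => x_of_grad_z l y w th k)).
have nk := nxt_neq_cur k.
transitivity ((f_x P (x (cur k)) (u k) th)^T *m dlam (nxt k) + (- 1%:M) *m dlam (cur k)
  + L_xx P lam x u th k *m dx (cur k) + L_xu P lam x u th k *m du k); last first.
  by rewrite mulNmx mul1mx -addrA addrC addrA.
congr (_ + _ + _).
- apply: sum_mulmx2 => [|||l ln lc] //.
  + apply: (Jac_affine _ (c := grad (fun a => stage_cost P (a, u k, th)) (x (cur k))
      - lam (cur k))) => b.
    by rewrite grad_xE /= eqxx eq_sym (negbTE nk) addrCA addrA.
  + apply: (Jac_affine _ (c := grad (fun a => stage_cost P (a, u k, th)) (x (cur k))
      + (f_x P (x (cur k)) (u k) th)^T *m lam (nxt k))) => b.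
    by rewrite grad_xE /= eqxx (negbTE nk) mulNmx mul1mx addrC.
  + apply: (Jac_cst _ (c := grad_x P lam x u th k)) => b.
    by rewrite !grad_xE /= ![_ == l]eq_sym (negbTE lc) (negbTE ln).
- apply: sum_mulmx1 => // l /negbTE lc.
  apply: (Jac_cst _ (c := grad_x P lam x u th k)) => b.
  by rewrite !grad_xE /= eq_sym lc.
- apply: sum_mulmx1 => // l /negbTE lk.
  apply: (Jac_cst _ (c := grad_x P lam x u th k)) => b.
  by rewrite !grad_xE /= eq_sym lk.
Qed.

Lemma row_x_max : x_of (L_zz P z th *m dz) ord_max =
  phi_xx P (x ord_max) th *m dx ord_max - dlam ord_max.
Proof.
rewrite x_of_mul x_of_Jac.
rewrite (Jac_stack _ _ _ _ _ _ (fun l y w => x_of_grad_z_max l y w th)).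
set c := grad (fun b => final_cost P (b, th)) (x ord_max).
transitivity ((- 1%:M) *m dlam ord_max + phi_xx P (x ord_max) th *m dx ord_max + 0).
  congr (_ + _ + _).
  - apply: sum_mulmx1 => [|l /negbTE lm].
      by apply: (Jac_affine _ (c := c)) => b; rewrite /= eqxx mulNmx mul1mx addrC.
    by apply: (Jac_cst _ (c := c - lam ord_max)) => b; rewrite /= eq_sym lm.
  - apply: sum_mulmx1 => [|l /negbTE lm].
      by apply: (Jac_incr _ (c := - lam ord_max)) => b; rewrite /= eqxx.
    by apply: (Jac_cst _ (c := c - lam ord_max)) => b; rewrite /= eq_sym lm.
  - by apply: sum_mulmx0 => l; apply: Jac_cst.
by rewrite mulNmx mul1mx addr0 addrC.
Qed.

Lemma row_u k : u_of (L_zz P z th *m dz) k =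
  L_ux P lam x u th k *m dx (cur k) + L_uu P lam x u th k *m du k
  + (f_u P (x (cur k)) (u k) th)^T *m dlam (nxt k).
Proof.
rewrite u_of_mul u_of_Jac.
rewrite (Jac_stack _ _ _ _ _ _ (fun l y w => u_of_grad_z l y w th k)).
transitivity ((f_u P (x (cur k)) (u k) th)^T *m dlam (nxt k)
  + L_ux P lam x u th k *m dx (cur k) + L_uu P lam x u th k *m du k); last first.
  by rewrite -addrA addrC.
congr (_ + _ + _).
- apply: sum_mulmx1 => [|l /negbTE ln].
    apply: (Jac_affine _
      (c := grad (fun a => stage_cost P (x (cur k), a, th)) (u k))) => b.
    by rewrite grad_uE /= eqxx addrC.
  apply: (Jac_cst _ (c := grad_u P lam x u th k)) => b.
  by rewrite !grad_uE /= eq_sym ln.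
- apply: sum_mulmx1 => // l /negbTE lc.
  apply: (Jac_cst _ (c := grad_u P lam x u th k)) => b.
  by rewrite !grad_uE /= eq_sym lc.
- apply: sum_mulmx1 => // l /negbTE lk.
  apply: (Jac_cst _ (c := grad_u P lam x u th k)) => b.
  by rewrite !grad_uE /= eq_sym lk.
Qed.

End Rows.
End Lagrangian.

(** * Block rows of the parameter derivative *)

Section ThetaRows.
Context (R : realType) (N nx nu nth : nat) (P : ocp R nx nu nth).
Context (lam x : 'I_N.+1 -> 'cV[R]_nx) (u : 'I_N -> 'cV[R]_nu) (th : 'cV[R]_nth).

Lemma theta_row_lam0 : lam_of (L_zth P (stack lam x u) th) ord0 = Jac (init P) th.
Proof.
rewrite lam_of_Jac; apply: (Jac_incr _ (c := - x ord0)) => t.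
by rewrite lam_of_grad_z defect0.
Qed.

Lemma theta_row_lam_nxt k :
  lam_of (L_zth P (stack lam x u) th) (nxt k) = f_th P (x (cur k)) (u k) th.
Proof.
rewrite lam_of_Jac; apply: (Jac_incr _ (c := - x (nxt k))) => t.
by rewrite lam_of_grad_z defect_nxt.
Qed.

Lemma theta_row_x k :
  x_of (L_zth P (stack lam x u) th) (cur k) = L_xth P lam x u th k.
Proof.
by rewrite x_of_Jac /L_xth; apply: eq_Jac => t; rewrite x_of_grad_z.
Qed.

Lemma theta_row_u k : u_of (L_zth P (stack lam x u) th) k = L_uth P lam x u th k.
Proof.
by rewrite u_of_Jac /L_uth; apply: eq_Jac => t; rewrite u_of_grad_z.
Qed.

Lemma theta_row_x_max : (forall y, differentiable (final_cost P) y) ->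
  x_of (L_zth P (stack lam x u) th) ord_max = phi_xth P (x ord_max) th.
Proof.
move=> dphi; rewrite x_of_Jac; apply: (Jac_incr _ (c := - lam ord_max)) => t.
by rewrite x_of_grad_z_max.
Qed.
End ThetaRows.

(** * The linear system read block by block *)

Lemma stack_eq0P (R : realType) (N nx nu p : nat) (W : 'M[R]_(nz N nx nu, p)) :
  W = 0 <-> [/\ lam_of W ord0 = 0, forall k, lam_of W (nxt k) = 0,
                forall k, x_of W (cur k) = 0, x_of W ord_max = 0
              & forall k, u_of W k = 0].
Proof.
split=> [->|[l0 ln xc xm uk]].
  have z0 : 0 = stack (fun=> 0) (fun=> 0) (fun=> 0) :> 'M[R]_(nz N nx nu, p).
    by rewrite /stack !col_mx0 mxcol0 col_mx0.
  by rewrite z0; have [-> -> ->] := @stackK R N nx nu p (fun=> 0) (fun=> 0) (fun=> 0).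
rewrite -(unstackK W).
have -> : lam_of W = fun=> 0.
  by apply/funext => k; case: (unliftP ord0 k) => [j|] ->; [exact: ln|].
have -> : x_of W = fun=> 0.
  by apply/funext => k; case: (unliftP ord_max k) => [j|] ->; rewrite ?lift_max_cur.
have -> : u_of W = fun=> 0 by apply/funext.
by rewrite /stack !col_mx0 mxcol0 col_mx0.
Qed.

Theorem corollary4 (R : realType) (N nx nu nth : nat)
    (N_gt0 : (0 < N)%N) (nx_gt0 : (0 < nx)%N) (nu_gt0 : (0 < nu)%N)
    (nth_gt0 : (0 < nth)%N)
    (P : ocp R nx nu nth)
    (f_C2 : C2 (dyn P)) (l_C2 : C2 (stage_cost P)) (phi_C2 : C2 (final_cost P))
    (xi_C1 : C1 (init P))
    (th : 'cV[R]_nth)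
    (x : 'I_N.+1 -> 'cV[R]_nx) (u : 'I_N -> 'cV[R]_nu)
    (tau_sol : solution P th x u)
    (lam : 'I_N.+1 -> 'cV[R]_nx)
    (stationary : grad_z P (stack lam x u) th = 0)
    (L_zz_inv : L_zz P (stack lam x u) th \in unitmx)
    (dlam dx : 'I_N.+1 -> 'M[R]_(nx, nth)) (du : 'I_N -> 'M[R]_(nu, nth)) :
  diff_pontryagin P lam x u th dlam dx du <->
  stack dlam dx du =
    - (invmx (L_zz P (stack lam x u) th)) *m L_zth P (stack lam x u) th.
Proof.
have [[df _] [dl _] [dphi _]] := And3 f_C2 l_C2 phi_C2.
set A := L_zz P _ _; set B := L_zth P _ _; set S := stack dlam dx du.
have -> : (S = - invmx A *m B) <-> (A *m S + B = 0).
  split=> [->|AS]; first by rewrite mulNmx mulmxN mulKVmx ?addNr.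
  by rewrite mulNmx -mulmxN -(addr0_eq AS) opprK mulKmx.
rewrite stack_eq0P lam_ofD x_ofD row_lam0 theta_row_lam0 row_x_max// theta_row_x_max//.
have rl k : lam_of (A *m S + B) (nxt k) = f_x P (x (cur k)) (u k) th *m dx (cur k)
    + f_u P (x (cur k)) (u k) th *m du k + f_th P (x (cur k)) (u k) th - dx (nxt k).
  by rewrite lam_ofD row_lam_nxt// theta_row_lam_nxt addrAC.
have rx k : x_of (A *m S + B) (cur k) = L_xx P lam x u th k *m dx (cur k)
    + L_xu P lam x u th k *m du k + (f_x P (x (cur k)) (u k) th)^T *m dlam (nxt k)
    + L_xth P lam x u th k - dlam (cur k).
  by rewrite x_ofD row_x_cur// theta_row_x addrAC.
have ru k : u_of (A *m S + B) k = L_ux P lam x u th k *m dx (cur k)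
    + L_uu P lam x u th k *m du k + (f_u P (x (cur k)) (u k) th)^T *m dlam (nxt k)
    + L_uth P lam x u th k.
  by rewrite u_ofD row_u// theta_row_u.
rewrite (addrC (- dx ord0)) (addrAC _ (- dlam ord_max)).
split=> [[e1 e2 e3 e4 e5]|[e1 e2 e3 e5 e4]]; split.
- by rewrite e1 subrr.
- by move=> k; rewrite rl -e2 subrr.
- by move=> k; rewrite rx -e3 subrr.
- by rewrite e5 subrr.
- by move=> k; rewrite ru -e4.
- by apply/esym/subr0_eq.
- by move=> k; apply/esym/subr0_eq; rewrite -rl.
- by move=> k; apply/esym/subr0_eq; rewrite -rx.
- by move=> k; rewrite -ru e4.
- by apply/esym/subr0_eq.
Qed.
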